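(* Let $G_p$ and $G_c$ be IF-OFP systems with passivity indices $(\nu_p,\rho_p)$ and $(\nu_c,\rho_c)$ respectively, $\nu_p,\rho_p,\nu_c,\rho_c\in\mathbb{R}$, interconnected in the plant-side event-triggered feedback loop described in the context, where the event instants $t_k$ are determined by the triggering condition $\|e_p(t)\|_2^2>\delta\|y_p(t)\|_2^2$ with $\delta\in(0,1]$. Put $w(t)=\begin{bmatrix} w_1(t)\\ w_2(t)\end{bmatrix}$, $y(t)=\begin{bmatrix} y_p(t)\\ y_c(t)\end{bmatrix}$. Then the event-triggered networked control system is QSR-dissipative with respect to the inputs $w$ and outputs $y$, and satisfies $$\dot V(t)\le w^T(t)Rw(t)+2w^T(t)Sy(t)+y^T(t)Qy(t)$$ for a storage function $V$ of the interconnection, where $$S=\begin{bmatrix}\tfrac12 I&\nu_p I\\-\nu_c I&\tfrac12 I\end{bmatrix},\quad R=\begin{bmatrix}-\nu_p I&0\\0&-(\nu_c-|\nu_c|)I\end{bmatrix},\quad Q=\begin{bmatrix}-\beta(\nu_c)I&0\\0&-(\rho_c+\nu_p-\tfrac14)I\end{bmatrix}$$ and $$\beta(\nu_c)=\begin{cases}\rho_p-\nu_c-\delta(1+\nu_c)&\text{if }\nu_c>0,\\ \rho_p-\delta&\text{if }\nu_c=0,\\ \rho_p+2\nu_c-\delta(1-3\nu_c)&\text{if }\nu_c<0.\end{cases}$$ Additionally, if $Q<0$, that is, $\beta(\nu_c)>0$ and $\rho_c+\nu_p-\tfrac14>0$, then the interconnection is (finite gain) $L_2$-stable from $w$ to 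$y$.
   Context: Systems: a system $G$ has the form $\dot x=f(x,u)$, $y=h(x,u)$ with state $x\in X\subset\mathbb{R}^n$ and $u(t),y(t)\in\mathbb{R}^m$. A storage function is a nonnegative function $V$ of the state; it is taken differentiable, and $\dot V(t)$ is the time derivative along solutions. $G$ is IF-OFP (input feed-forward output feedback passive) with input passivity index $\nu\in\mathbb{R}$ and output passivity index $\rho\in\mathbb{R}$ (of either sign) if there is a storage function $V$ with $\dot V\le u^Ty-\rho y^Ty-\nu u^Tu$ for all $t$ along all solutions. Plant-side event-triggered loop: $G_p$ (plant, state $x_p$, input $u_p$, output $y_p$) has indices $(\nu_p,\rho_p)$, and $G_c$ (controller, state $x_c$, input $u_c$, output $y_c$) has indices $(\nu_c,\rho_c)$; all inputs and outputs are $\mathbb{R}^m$-valued. External signals $w_1,w_2$ are $\mathbb{R}^m$-valued. At event instants $t_k$ the plant output is sampled and sent to the controller, and is held constant until the next event. For $t\in[t_k,t_{k+1})$: $u_p(t)=w_1(t)-y_c(t)$, $u_c(t)=w_2(t)+y_p(t_k)$, $e_p(t)=y_p(t)-y_p(t_k)$ (so $u_c=w_2+y_p-e_p$). A new event is triggered as soon as $\|e_p(t)\|_2^2>\delta\|y_p(t)\|_2^2$ (Euclidean norm of the vectors at time $t$), so that $e_p^T(t)e_p(t)\le\delta\, y_p^T(t)y_p(t)$ holds at all times. A storage function of the interconnection is a nonnegative function $V$ of $(x_p,x_c)$; inequalities on $\dot V$ are required along all solutions for all $t$ in the intervals $[t_k,t_{k+1})$. A system with input $w$ and output $y$ is QSR-dissipative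 if there is a storage function $V$ with $\dot V\le y^TQy+2y^TSw+w^TRw$ (dissipative with a quadratic supply rate, up to transposing $S$), with $Q,S,R$ constant matrices and $Q,R$ symmetric. It is finite gain $L_2$-stable if there are a positive semidefinite function $V$ of the state and a constant $\gamma>0$ such that $V(t_1)-V(0)\le\int_0^{t_1}(\gamma^2w^Tw-y^Ty)\,dt$ for all inputs and all $t_1>0$. $I$ is the $m\times m$ identity. *)

(* Defs.v *)
From HB Require Import structures.
From mathcomp Require Import all_boot all_order all_algebra.
From mathcomp Require Import all_classical all_reals all_analysis.
Import Order.TTheory GRing.Theory Num.Theory.
Import numFieldNormedType.Exports.

Set Implicit Arguments.
Unset Strict Implicit.
Unset Printing Implicit Defensive.

Local Open Scope classical_set_scope.
Local Open Scope ring_scope.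

Definition dot (R : realType) (n : nat) (u v : 'cV[R]_n) : R :=
  (u^T *m v) 0 0.

(* The half-open interval [s, T), with T possibly +oo. *)
Definition time_span (R : realType) (s : R) (T : \bar R) : set R :=
  [set t | s <= t /\ (t%:E < T)%E].

(* Right-hand derivative.  Inputs of the event-triggered loop jump at event
   instants, so on the half-open intervals [t_k, t_(k+1)) time derivatives are
   taken from the right; they are the usual ones wherever those exist. *)
Definition is_rderive (R : realType) (W : normedModType R)
    (f : R -> W) (t : R) (l : W) : Prop :=
  h^-1 *: (f (t + h) - f t) @[h --> 0^'+] --> l.

(* Admissible signals: right-continuous with left limits.  This covers the
   piecewise continuous signals with the value at a jump taken from the right,
   and makes quadratic functions of them integrable on compact intervals. *)
Definition cadlag (R : realType) (W : normedModType R)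
    (s : R) (T : \bar R) (u : R -> W) : Prop :=
  (forall t, time_span s T t -> u r @[r --> t^'+] --> u t) /\
  (forall t, time_span s T t -> s < t -> cvg (u r @[r --> t^'-])).

(* x' = f(x, u), y = h(x, u) with x in X; f and h are total functions whose
   values outside of X are never used. *)
Record system (R : realType) (n m : nat) := System {
  states : set 'cV[R]_n;
  dyn : 'cV[R]_n -> 'cV[R]_m -> 'cV[R]_n;
  outp : 'cV[R]_n -> 'cV[R]_m -> 'cV[R]_m }.

(* (x, u, y) is a solution of G on [s, T).  T need not be +oo: finite escape
   times (and, for the loop below, accumulation of events) are allowed. *)
Definition solution (R : realType) (n m : nat) (G : system R n m)
    (s : R) (T : \bar R) (x : R -> 'cV[R]_n) (u y : R -> 'cV[R]_m) : Prop :=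
  [/\ cadlag s T u, cadlag s T y, {within time_span s T, continuous x} &
      forall t, time_span s T t ->
        [/\ states G (x t), is_rderive x t (dyn G (x t) (u t)) &
            y t = outp G (x t) (u t)]].

(* Dissipativity notions are stated for anything that has a state space and
   trajectories (horizon T, state x, input w, output y) on [0, T); both a
   single system and the event-triggered loop are of this kind. *)
Record io_system (R : realType) (n p q : nat) := IOSystem {
  io_states : set 'cV[R]_n;
  io_traj : \bar R -> (R -> 'cV[R]_n) -> (R -> 'cV[R]_p) ->
            (R -> 'cV[R]_q) -> Prop }.

Definition io_of_system (R : realType) (n m : nat) (G : system R n m) :
    io_system R n m m :=
  IOSystem (states G) (solution G 0).

Definition storage_function (R : realType) (n : nat) (X : set 'cV[R]_n)
    (V : 'cV[R]_n -> R) : Prop :=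
  (forall x, X x -> 0 <= V x) /\ (forall x, X x -> differentiable V x).

(* dV/dt exists and is at most the supply rate s(w, y), for all t along all
   trajectories. *)
Definition dissipation_inequality (R : realType) (n p q : nat)
    (B : io_system R n p q) (V : 'cV[R]_n -> R)
    (s : 'cV[R]_p -> 'cV[R]_q -> R) : Prop :=
  forall T x w y, io_traj B T x w y -> forall t, time_span 0 T t ->
    exists2 d : R, is_rderive (fun r => V (x r)) t d & d <= s (w t) (y t).

Definition IF_OFP (R : realType) (n m : nat) (B : io_system R n m m)
    (nu rho : R) : Prop :=
  exists2 V, storage_function (io_states B) V &
    dissipation_inequality B V
      (fun u y => dot u y - rho * dot y y - nu * dot u u).

Definition QSR_dissipative (R : realType) (n p q : nat)
    (B : io_system R n p q)
    (Q : 'M[R]_q) (S : 'M[R]_(q, p)) (Rm : 'M[R]_p) : Prop :=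
  [/\ Q^T = Q, Rm^T = Rm &
    exists2 V, storage_function (io_states B) V &
      dissipation_inequality B V
        (fun w y => dot y (Q *m y) + 2 * dot y (S *m w) + dot w (Rm *m w))].

Definition L2_stable (R : realType) (n p q : nat)
    (B : io_system R n p q) : Prop :=
  exists (V : 'cV[R]_n -> R) (gamma : R),
    [/\ forall x, io_states B x -> 0 <= V x, 0 < gamma &
      forall T x w y, io_traj B T x w y ->
      forall t1 : R, 0 < t1 -> (t1%:E < T)%E ->
        V (x t1) - V (x 0) <=
        \int[lebesgue_measure]_(t in `[0, t1])
          (gamma ^+ 2 * dot (w t) (w t) - dot (y t) (y t))].

Definition negdefmx (R : realType) (n : nat) (A : 'M[R]_n) : Prop :=
  A^T = A /\ forall v : 'cV[R]_n, v != 0 -> dot v (A *m v) < 0.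

Record loop_signals (R : realType) (np nc m : nat) := LoopSignals {
  xp : R -> 'cV[R]_np; up : R -> 'cV[R]_m; yp : R -> 'cV[R]_m;
  xc : R -> 'cV[R]_nc; uc : R -> 'cV[R]_m; yc : R -> 'cV[R]_m }.

Definition same_signals (R : realType) (np nc m : nat) (I : set R)
    (r r' : loop_signals R np nc m) : Prop :=
  forall t, I t ->
    [/\ xp r t = xp r' t, up r t = up r' t, yp r t = yp r' t &
      [/\ xc r t = xc r' t, uc r t = uc r' t & yc r t = yc r' t]].

(* The feedback interconnection on [s, T) with the plant output sampled at time
   s and held, no event being generated. *)
Definition held_feedback (R : realType) (np nc m : nat)
    (s : R) (T : \bar R) (w1 w2 : R -> 'cV[R]_m)
    (r : loop_signals R np nc m) : Prop :=
  forall t, time_span s T t ->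
    up r t = w1 t - yc r t /\ uc r t = w2 t + yp r s.

Definition loop_solution (R : realType) (np nc m : nat)
    (Gp : system R np m) (Gc : system R nc m)
    (s : R) (T : \bar R) (r : loop_signals R np nc m) : Prop :=
  solution Gp s T (xp r) (up r) (yp r) /\
  solution Gc s T (xc r) (uc r) (yc r).

Definition sampling_error (R : realType) (np nc m : nat) (s : R)
    (r : loop_signals R np nc m) (t : R) : 'cV[R]_m :=
  yp r t - yp r s.

(* Times of [s, T) at which |e_p|^2 > delta |y_p|^2, for the sample taken at s. *)
Definition triggering_times (R : realType) (np nc m : nat) (delta s : R)
    (T : \bar R) (r : loop_signals R np nc m) : set R :=
  [set t | time_span s T t /\
    delta * dot (yp r t) (yp r t) <
    dot (sampling_error s r t) (sampling_error s r t)].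

(* The signals r solve the event-triggered loop on [0, T) with event instants
   tk 0 = 0 < tk 1 < ...; tk k = +oo means that the k-th event never occurs, and
   entries at or beyond T play no role.
   The rule "an event is triggered as soon as |e_p|^2 > delta |y_p|^2" refers to
   what would happen if the sample were held any longer, whereas at tk k.+1 the
   actual signals already use the new sample.  Hence an event at s' = tk k.+1
   requires the loop with the sample of tk k still held to have a run r' past
   s', driven by the same w, that coincides with r before s' and whose first
   triggering time (infimum) is s'. *)
Definition event_triggered_solution (R : realType) (np nc m : nat)
    (delta : R) (Gp : system R np m) (Gc : system R nc m)
    (T : \bar R) (tk : nat -> \bar R) (w1 w2 : R -> 'cV[R]_m)
    (r : loop_signals R np nc m) : Prop :=
  [/\ loop_solution Gp Gc 0 T r,
      tk 0%N = 0%E /\ (forall j k, (j <= k)%N -> (tk j <= tk k)%E),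
      (forall t, time_span 0 T t -> exists k, (tk k <= t%:E < tk k.+1)%E) &
      forall (k : nat) (s : R), tk k = s%:E -> (s%:E < T)%E ->
        let s' := tk k.+1 in
        let I := mine s' T in
        [/\ (s%:E < s')%E,
            held_feedback s I w1 w2 r,
            triggering_times delta s I r = set0 &
            (s' < T)%E -> exists (T' : \bar R) (r' : loop_signals R np nc m),
              [/\ (s' < T')%E, loop_solution Gp Gc s T' r',
                  held_feedback s T' w1 w2 r',
                  same_signals (time_span s s') r r' &
                  s' = ereal_inf (EFin @` triggering_times delta s T' r')]]].

Definition event_triggered_loop (R : realType) (np nc m : nat)
    (delta : R) (Gp : system R np m) (Gc : system R nc m) :
    io_system R (np + nc) (m + m) (m + m) :=
  IOSystem
    [set z | states Gp (usubmx z) /\ states Gc (dsubmx z)]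
    (fun T x w y =>
       exists (tk : nat -> \bar R) (w1 w2 : R -> 'cV[R]_m)
              (r : loop_signals R np nc m),
         [/\ event_triggered_solution delta Gp Gc T tk w1 w2 r,
             x = (fun t => col_mx (xp r t) (xc r t)),
             w = (fun t => col_mx (w1 t) (w2 t)) &
             y = (fun t => col_mx (yp r t) (yc r t))]).

Definition beta (R : realType) (rhop delta nuc : R) : R :=
  if 0 < nuc then rhop - nuc - delta * (1 + nuc)
  else if nuc == 0 then rhop - delta
  else rhop + 2 * nuc - delta * (1 - 3 * nuc).

Definition Smx (R : realType) (m : nat) (nup nuc : R) : 'M[R]_(m + m) :=
  block_mx (1 / 2)%:M nup%:M (- nuc)%:M (1 / 2)%:M.

Definition Rmx (R : realType) (m : nat) (nup nuc : R) : 'M[R]_(m + m) :=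
  block_mx (- nup)%:M 0 0 (- (nuc - `|nuc|))%:M.

Definition Qmx (R : realType) (m : nat) (nup rhop nuc rhoc delta : R) :
    'M[R]_(m + m) :=
  block_mx (- beta rhop delta nuc)%:M 0 0 (- (rhoc + nup - 1 / 4))%:M.

(* Main.v *)
Require Import Defs.
From mathcomp Require Import all_boot all_order all_algebra.
From mathcomp Require Import all_classical all_reals all_analysis.
From mathcomp Require Import ring lra.
Import Order.TTheory GRing.Theory Num.Theory.
Import numFieldNormedType.Exports.

Set Implicit Arguments.
Unset Strict Implicit.
Unset Printing Implicit Defensive.

Local Open Scope classical_set_scope.
Local Open Scope ring_scope.

(** The storage function of the loop is the sum [Vp + Vc] of the storage functions
    of the plant and of the controller.  Adding the two passivity inequalities and
    substituting [up = w1 - yc] and [uc = w2 + yp - e], where [e] is the sampling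
    error, bounds its derivative by a quadratic form in [w1, w2, yp, yc, e].  The
    only information on [e] is [|e|^2 <= delta |yp|^2], which holds because no
    triggering time lies between consecutive events ([held_sample]).  Completing
    squares then bounds this form by the supply rate given by [Q], [S] and [R],
    which is free of [e] ([loop_supply_le]).

    If [Q] is negative definite, Young's inequality bounds this supply rate by
    [c (K |w|^2 - |y|^2)] with [c, K > 0] ([supply_le_gain]), so that
    [V = (Vp + Vc) / c] satisfies [V' <= K |w|^2 - |y|^2], and the gain is
    [sqrt K].  To integrate this, note that only right derivatives of [V] along
    trajectories exist, inputs being discontinuous at events.  But [V] is
    continuous along trajectories, and the right-hand side [g] is right-continuous
    with left limits ([loop_inputs_cadlag] for the external signals), hence
    measurable and bounded on compact intervals ([cadlag_integrable]).  Then [V]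
    minus the integral of [g] is continuous with nonpositive upper right
    derivative, so it does not increase ([increment_le_integral]). *)

(** * The Euclidean inner product *)

Section DotProduct.
Context {R : realType} {n : nat}.
Implicit Types (u v : 'cV[R]_n) (k : R).

Lemma dotE u v : dot u v = \sum_i u i 0 * v i 0.
Proof. by rewrite /dot mxE; apply: eq_bigr => i _; rewrite mxE. Qed.

Lemma dotC u v : dot u v = dot v u.
Proof. by rewrite !dotE; apply: eq_bigr => i _; rewrite mulrC. Qed.

Lemma dotDl u1 u2 v : dot (u1 + u2) v = dot u1 v + dot u2 v.
Proof. by rewrite /dot linearD/= mulmxDl mxE. Qed.

Lemma dotDr u v1 v2 : dot u (v1 + v2) = dot u v1 + dot u v2.
Proof. by rewrite /dot mulmxDr mxE. Qed.

Lemma dotZl k u v : dot (k *: u) v = k * dot u v.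
Proof. by rewrite /dot linearZ/= -scalemxAl mxE. Qed.

Lemma dotZr k u v : dot u (k *: v) = k * dot u v.
Proof. by rewrite dotC dotZl dotC. Qed.

Lemma dotNl u v : dot (- u) v = - dot u v.
Proof. by rewrite -scaleN1r dotZl mulN1r. Qed.

Lemma dotNr u v : dot u (- v) = - dot u v.
Proof. by rewrite dotC dotNl dotC. Qed.

Lemma dot_ge0 u : 0 <= dot u u.
Proof. by rewrite dotE; apply: sumr_ge0 => i _; rewrite -expr2 sqr_ge0. Qed.

Lemma dot_eq0 u : (dot u u == 0) = (u == 0).
Proof.
apply/idP/eqP => [|->]; last by rewrite /dot mulmx0 mxE.
rewrite dotE psumr_eq0 => [/allP u0|i _]; last by rewrite -expr2 sqr_ge0.
apply/matrixP => i j; rewrite !mxE ord1.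
have := u0 i (mem_index_enum i).
by rewrite -expr2 sqrf_eq0 => /eqP.
Qed.

Lemma dot_gt0 u : (0 < dot u u) = (u != 0).
Proof. by rewrite lt0r dot_ge0 andbT dot_eq0. Qed.

End DotProduct.

Definition dot_bilin := (@dotDl, @dotDr, @dotNl, @dotNr, @dotZl, @dotZr).

(** Transposing [S] exchanges the two forms [2 w^T S y] and [2 y^T S^T w] of the
    cross term of a quadratic supply rate. *)
Lemma dot_mulmx_trmx {R : realType} {p q : nat} (A : 'M[R]_(p, q)) u v :
  dot v (A^T *m u) = dot u (A *m v).
Proof. by rewrite dotC /dot trmx_mul trmxK mulmxA. Qed.

Lemma dot_col_mx {R : realType} {p q : nat}
    (u1 v1 : 'cV[R]_p) (u2 v2 : 'cV[R]_q) :
  dot (col_mx u1 u2) (col_mx v1 v2) = dot u1 v1 + dot u2 v2.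
Proof. by rewrite /dot tr_col_mx mul_row_col mxE. Qed.

Lemma scalar_block_mulmx {R : realType} {m : nat} (a b c d : R) (u v : 'cV[R]_m) :
  block_mx a%:M b%:M c%:M d%:M *m col_mx u v =
  col_mx (a *: u + b *: v) (c *: u + d *: v).
Proof. by rewrite mul_block_col !mul_scalar_mx. Qed.

(** * Supply rates *)

Section LoopSupply.
Context {R : realType} {m : nat}.
Variables (nup rhop nuc rhoc delta : R).
Implicit Types (w y e : 'cV[R]_m).

Lemma supply_col_mxE w1 w2 y1 y2 :
  dot (col_mx w1 w2) (Rmx m nup nuc *m col_mx w1 w2) +
  2 * dot (col_mx w1 w2) (Smx m nup nuc *m col_mx y1 y2) +
  dot (col_mx y1 y2) (Qmx m nup rhop nuc rhoc delta *m col_mx y1 y2) =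
  - nup * dot w1 w1 - (nuc - `|nuc|) * dot w2 w2 +
  (dot w1 y1 + 2 * nup * dot w1 y2 - 2 * nuc * dot w2 y1 + dot w2 y2) -
  beta rhop delta nuc * dot y1 y1 - (rhoc + nup - 1 / 4) * dot y2 y2.
Proof.
rewrite /Rmx /Qmx /Smx -!(raddf0 (@scalar_mx R m)) !scalar_block_mulmx.
by rewrite !dot_col_mx !dot_bilin; field.
Qed.

(** The cross terms [yp . yc] of the two passivity inequalities cancel.  What is
    left of the difference, right-hand side minus left-hand side, is
    [|yc / 2 + e|^2], plus [delta |yp|^2 - |e|^2], plus a term proportional to
    [nuc], the last coming from [nuc |uc|^2]:
    - for [nuc > 0], it is [nuc] times
      [|w2 - e|^2 + |yp - e|^2 + |yp|^2 + (delta |yp|^2 - |e|^2)];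
    - for [nuc < 0], it is [- nuc] times
      [|w2 + e|^2 + |yp + e|^2 + 3 (delta |yp|^2 - |e|^2)].
    The triggering rule makes [delta |yp|^2 - |e|^2] nonnegative. *)
Lemma loop_supply_le (w1 w2 yp yc e : 'cV[R]_m) :
  dot e e <= delta * dot yp yp ->
  let up := w1 - yc in let uc := w2 + yp - e in
  (dot up yp - rhop * dot yp yp - nup * dot up up) +
  (dot uc yc - rhoc * dot yc yc - nuc * dot uc uc) <=
  - nup * dot w1 w1 - (nuc - `|nuc|) * dot w2 w2 +
  (dot w1 yp + 2 * nup * dot w1 yc - 2 * nuc * dot w2 yp + dot w2 yc) -
  beta rhop delta nuc * dot yp yp - (rhoc + nup - 1 / 4) * dot yc yc.
Proof.
move=> e_le /=.
have sq_yc := dot_ge0 ((1 / 2) *: yc + e).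
have sq_yp := dot_ge0 yp.
move: sq_yc; rewrite !dot_bilin ?(dotC yp w1) ?(dotC yc w1) ?(dotC yc yp).
rewrite ?(dotC yp w2) ?(dotC yc w2) ?(dotC yp e) ?(dotC yc e) ?(dotC e w2) => sq_yc.
rewrite /beta; case: (ltrgt0P nuc) => [nuc_gt0|nuc_lt0|nuc0].
- have := dot_ge0 (w2 - e); have := dot_ge0 (yp - e).
  rewrite !dot_bilin (dotC e w2) (dotC yp e) => sq1 sq2.
  have := mulr_ge0 (ltW nuc_gt0) sq1; have := mulr_ge0 (ltW nuc_gt0) sq2.
  have := mulr_ge0 (ltW nuc_gt0) sq_yp.
  have : 0 <= nuc * (delta * dot yp yp - dot e e).
    by rewrite mulr_ge0 ?(ltW nuc_gt0)// subr_ge0.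
  lra.
- have nuc_ge0 : 0 <= - nuc by lra.
  have := dot_ge0 (w2 + e); have := dot_ge0 (yp + e).
  rewrite !dot_bilin (dotC e w2) (dotC yp e) => sq1 sq2.
  have := mulr_ge0 nuc_ge0 sq1; have := mulr_ge0 nuc_ge0 sq2.
  have : 0 <= - nuc * (delta * dot yp yp - dot e e).
    by rewrite mulr_ge0// subr_ge0.
  lra.
- by rewrite nuc0; lra.
Qed.

Lemma negdef_QmxP : (0 < m)%N ->
  negdefmx (Qmx m nup rhop nuc rhoc delta) <->
  0 < beta rhop delta nuc /\ 0 < rhoc + nup - 1 / 4.
Proof.
move=> m_gt0.
have QE (u v : 'cV[R]_m) :
    dot (col_mx u v) (Qmx m nup rhop nuc rhoc delta *m col_mx u v) =
    - beta rhop delta nuc * dot u u - (rhoc + nup - 1 / 4) * dot v v.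
  rewrite /Qmx -!(raddf0 (@scalar_mx R m)) !scalar_block_mulmx.
  by rewrite !dot_col_mx !dot_bilin; field.
split=> [[_ Qneg]|[beta_gt0 c_gt0]].
  pose o : 'cV[R]_m := const_mx 1.
  have o_gt0 : 0 < dot o o.
    rewrite dot_gt0; apply/eqP => /matrixP/(_ (Ordinal m_gt0) 0).
    by rewrite !mxE; apply/eqP; rewrite oner_eq0.
  have dot00 : dot 0 (0 : 'cV[R]_m) = 0 by apply/eqP; rewrite dot_eq0.
  have o0 : col_mx o 0 != 0 :> 'cV[R]_(m + m).
    by rewrite -dot_gt0 dot_col_mx dot00 addr0.
  have oo : col_mx 0 o != 0 :> 'cV[R]_(m + m).
    by rewrite -dot_gt0 dot_col_mx dot00 add0r.
  have := Qneg _ o0; have := Qneg _ oo; rewrite !QE !dot00 !mulr0 subr0 sub0r.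
  by rewrite mulNr !oppr_lt0 !(pmulr_lgt0 _ o_gt0).
split; first by rewrite /Qmx tr_block_mx !tr_scalar_mx !trmx0.
move=> z; rewrite -[z]vsubmxK QE -dot_gt0 dot_col_mx.
set u := usubmx z; set v := dsubmx z => uv_gt0.
have u_ge0 := mulr_ge0 (ltW beta_gt0) (dot_ge0 u).
have := dot_ge0 v; rewrite le0r => /orP[/eqP v0|/(mulr_gt0 c_gt0)]; last by lra.
by move: uv_gt0; rewrite v0 addr0 => /(mulr_gt0 beta_gt0); lra.
Qed.

(** Negative definiteness of [Q] dominates the cross terms between inputs and
    outputs, at the price of a multiple of the squared norm of the inputs.  Each
    output occurs in two cross terms; spending a quarter of the smaller eigenvalue
    of [- Q] on each of the four leaves at least half of it. *)
Lemma supply_le_gain : 0 < beta rhop delta nuc -> 0 < rhoc + nup - 1 / 4 ->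
  exists c K : R, [/\ 0 < c, 0 < K & forall w1 w2 y1 y2,
  - nup * dot w1 w1 - (nuc - `|nuc|) * dot w2 w2 +
  (dot w1 y1 + 2 * nup * dot w1 y2 - 2 * nuc * dot w2 y1 + dot w2 y2) -
  beta rhop delta nuc * dot y1 y1 - (rhoc + nup - 1 / 4) * dot y2 y2 <=
  c * (K * (dot w1 w1 + dot w2 w2) - (dot y1 y1 + dot y2 y2))].
Proof.
set a := beta _ _ _; set b := _ - _ => a_gt0 b_gt0.
pose c := Num.min a b.
have c_gt0 : 0 < c by rewrite lt_min a_gt0.
have ca : c <= a by rewrite ge_min lexx.
have cb : c <= b by rewrite ge_min lexx orbT.
pose K := `|nup| + 2 * `|nuc| + (2 + 4 * nup ^+ 2 + 4 * nuc ^+ 2) / c.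
have K_gt0 : 0 < K.
  rewrite /K ltr_wpDl ?addr_ge0// ?mulr_ge0// divr_gt0//.
  by have := sqr_ge0 nup; have := sqr_ge0 nuc; lra.
exists (c / 2), (2 / c * K); split.
- by rewrite divr_gt0.
- by rewrite mulr_gt0// divr_gt0.
move=> w1 w2 y1 y2.
have -> : c / 2 * (2 / c * K * (dot w1 w1 + dot w2 w2) -
                   (dot y1 y1 + dot y2 y2)) =
    K * (dot w1 w1 + dot w2 w2) - c / 2 * (dot y1 y1 + dot y2 y2).
  by field; rewrite gt_eqF.
(* Young's inequality, as nonnegativity of the square of k p / c - q / 2 *)
have young (k : R) (p q : 'cV[R]_m) :
    k * dot p q <= k ^+ 2 / c * dot p p + c / 4 * dot q q.
  have := mulr_ge0 (ltW c_gt0) (dot_ge0 ((k / c) *: p - (1 / 2) *: q)).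
  rewrite -(subr_ge0 (k * _)); congr (0 <= _).
  by rewrite !dot_bilin (dotC q p); field; rewrite gt_eqF.
have := young 1 w1 y1; have := young (2 * nup) w1 y2.
have := young (- 2 * nuc) w2 y1; have := young 1 w2 y2.
have h1 : 0 <= (`|nup| + nup) * dot w1 w1.
  by rewrite mulr_ge0 ?dot_ge0//; have := ler_norm (- nup); rewrite normrN; lra.
have h2 : 0 <= (`|nuc| + nuc) * dot w2 w2.
  by rewrite mulr_ge0 ?dot_ge0//; have := ler_norm (- nuc); rewrite normrN; lra.
have h3 : 0 <= `|nuc| * dot w1 w1 by rewrite mulr_ge0 ?dot_ge0.
have h4 : 0 <= `|nup| * dot w2 w2 by rewrite mulr_ge0 ?dot_ge0.
have h5 : 0 <= (a - c) * dot y1 y1 by rewrite mulr_ge0 ?dot_ge0// subr_ge0.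
have h6 : 0 <= (b - c) * dot y2 y2 by rewrite mulr_ge0 ?dot_ge0// subr_ge0.
have ic : 0 <= c^-1 by rewrite invr_ge0 ltW.
have h7 : 0 <= (1 + 4 * nuc ^+ 2) / c * dot w1 w1.
  by rewrite !mulr_ge0 ?dot_ge0// addr_ge0// mulr_ge0// sqr_ge0.
have h8 : 0 <= (1 + 4 * nup ^+ 2) / c * dot w2 w2.
  by rewrite !mulr_ge0 ?dot_ge0// addr_ge0// mulr_ge0// sqr_ge0.
have h9 : 0 <= `|nuc| * dot w2 w2 by rewrite mulr_ge0 ?dot_ge0.
rewrite /K; move: h1 h2 h3 h4 h5 h6 h7 h8 h9 {young}.
move: (c^-1) (`|nup|) (`|nuc|) => ci np' nc'; lra.
Qed.

End LoopSupply.

(** * Integrating one-sided differential inequalities *)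

(** A Dini derivative argument.  For a slope [eps > 0], let [c] be the supremum of
    the times at which [H] is at most the affine function of slope [eps] taking the
    value [H a] at [a].  Continuity puts [c] in that set, and the growth bound to the right
    of [c] would provide a later member if [c < b]. *)
Lemma le_of_right_growth {R : realType} (H : R -> R) (a b : R) : a <= b ->
  {within `[a, b], continuous H} ->
  (forall t, a <= t -> t < b -> forall eps, 0 < eps ->
    \forall r \near t^'+, H r - H t <= eps * (r - t)) ->
  H b <= H a.
Proof.
move=> ab /subspace_continuousP Hcont Hgrow.
suff Hle eps : 0 < eps -> H b <= H a + eps * (b - a).
  apply/ler_addgt0Pr => e e_gt0.
  have [eq_ab|neq_ab] := eqVneq a b; first by rewrite eq_ab lerDl ltW.
  have ba_gt0 : 0 < b - a by rewrite subr_gt0 lt_neqAle neq_ab.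
  by have := Hle _ (divr_gt0 e_gt0 ba_gt0); rewrite divfK ?gt_eqF.
move=> eps_gt0.
pose A := [set t | a <= t <= b /\ H t <= H a + eps * (t - a)].
have Aa : A a by split; rewrite ?lexx ?ab// subrr mulr0 addr0.
have Aub : ubound A b by move=> t [/andP[]].
have supA : has_sup A by split; [exists a|exists b].
pose c := sup A.
have ac : a <= c by apply: ub_le_sup => //; exists b.
have cb : c <= b by apply: ge_sup => //; exists a.
have abc : `[a, b]%classic c by rewrite /= in_itv/= ac cb.
have Ac : A c.
  split; first by rewrite ac cb.
  rewrite leNgt; apply/negP => gap.
  have cont_gap : (fun r => H r - eps * (r - a)) r @[r --> within `[a, b] (nbhs c)]
      --> H c - eps * (c - a).
    apply: cvgB; first exact: Hcont.
    apply: cvgM; first exact: cvg_cst.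
    apply: cvg_within_filter.
    by apply: cvgB; [exact: cvg_id|exact: cvg_cst].
  have gap' : H a < H c - eps * (c - a) by lra.
  have := cvgr_gt _ cont_gap _ gap'.
  rewrite near_withinE => -[/= d d_gt0 far].
  have [t At ct] := sup_adherent d_gt0 supA.
  have tc : t <= c by apply: ub_le_sup => //; exists b.
  case: At => tab; rewrite leNgt => /negP; apply.
  suff : H a < H t - eps * (t - a) by lra.
  apply: far; last by rewrite /= in_itv.
  by rewrite /= ger0_norm ?subr_ge0//; move: ct; rewrite -/c; lra.
have [eq_cb|neq_cb] := eqVneq c b; first by case: Ac => _; rewrite eq_cb.
have lt_cb : c < b by rewrite lt_neqAle neq_cb.
near (c^'+) => r.
have cr : c < r by near: r; exact: nbhs_right_gt.
have rb : r <= b by near: r; exact: nbhs_right_le.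
suff /(ub_le_sup _) : A r by move=> /(_ (ex_intro _ b Aub)); rewrite leNgt -/c cr.
split; first by rewrite rb (le_trans ac (ltW cr)).
have : H r - H c <= eps * (r - c) by near: r; exact: Hgrow.
by case: Ac => _; lra.
Unshelve. all: by end_near. Qed.

(** A right-continuous function is the pointwise limit of the functions
    [x |-> f (step n x)], where [step n x] is the first multiple of [1 / (n + 1)]
    strictly to the right of [x].  Each of these is constant on countably many
    intervals, whatever [f] is. *)
Lemma measurable_right_continuous {R : realType} (D : set R) (f : R -> R) :
  measurable D -> (forall x, D x -> f r @[r --> x^'+] --> f x) ->
  measurable_fun D f.
Proof.
move=> mD fD.
pose step (n : nat) (x : R) : R := (Num.floor (x * n.+1%:R) + 1)%:~R / n.+1%:R.
apply: (@measurable_realfun.measurable_fun_cvg _ _ _ _ (fun n => f \o step n))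
  => [n _ Y mY|x Dx].
  apply: measurableI => //.
  have -> : (f \o step n) @^-1` Y =
      \bigcup_(k in [set k : int | Y (f ((k + 1)%:~R / n.+1%:R))])
      `[k%:~R / n.+1%:R, (k + 1)%:~R / n.+1%:R[%classic.
    apply/seteqP; split => x /=.
      move=> Yx; exists (Num.floor (x * n.+1%:R)) => //=.
      by rewrite in_itv/= ler_pdivrMr// ltr_pdivlMr// floor_le floorD1_gt.
    move=> [k /= Yk]; rewrite in_itv/= ler_pdivrMr// ltr_pdivlMr// -floor_eq.
    by rewrite /step => /eqP ->.
  by rewrite bigcup_mkcond; apply: countable_bigcupT_measurable => // k; case: ifP.
apply: (@cvg_comp _ _ _ (step ^~ x) f _ (x^'+)); last exact: fD.
have step_gt n : x < step n x by rewrite /step ltr_pdivlMr// floorD1_gt.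
have step_cvg : step ^~ x @ \oo --> x.
  apply: (@squeeze_cvgr _ _ _ _ (cst x) (fun n => x + harmonic n)).
  - apply: nearW => n; rewrite ltW//= /step ler_pdivrMr// mulrDl mulVf// intrD lerD2r.
    exact: floor_le.
  - exact: cvg_cst.
  - by rewrite -[X in _ --> X]addr0; apply: cvgD; [exact: cvg_cst|exact: cvg_harmonic].
move=> Y xY; have [N NN sY] := step_cvg (fun y => x < y -> Y y) xY.
by exists N => // n /sY; apply; exact: step_gt.
Qed.

(** One-sided limits give local bounds on either side, and compactness makes them
    uniform. *)
Lemma cadlag_bounded {R : realType} (W : normedModType R) (g : R -> W)
    (a b : R) (T : \bar R) :
  cadlag a T g -> (b%:E < T)%E -> [bounded g t | t in `[a, b]].
Proof.
move=> [g_right g_left] bT.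
have locally_bounded x : x \in `[a, b] ->
    exists C, \forall r \near x, a <= r -> `|g r| <= C.
  rewrite in_itv/= => /andP[ax xb].
  have xT : time_span a T x by split; rewrite // (le_lt_trans _ bT)// lee_fin.
  have near_le (F : set_system R) (l : W) : Filter F -> g r @[r --> F] --> l ->
      \forall r \near F, `|g r| <= `|l| + 1.
    move=> FF gl; apply: (cvgr_le _ (cvg_norm gl)); first by rewrite ltrDl.
  have [l left_bound] : exists l : W, \forall r \near x^'-, a <= r -> `|g r| <= `|l| + 1.
    have [ltax|leax] := ltP a x.
      have /cvg_ex[/= l gl] := g_left x xT ltax.
      by exists l; near=> r => _; near: r; exact: near_le gl.
    exists 0; near=> r => ar; suff : r < x by rewrite ltNge (le_trans leax ar).
    by near: r; exact: nbhs_left_lt.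
  exists (`|g x| + `|l| + 1).
  have : \forall r \near x^'+, `|g r| <= `|g x| + 1.
    exact: near_le (g_right x xT).
  rewrite near_withinE => right_bound.
  move: left_bound; rewrite near_withinE => left_bound.
  near=> r => ar; have [rx|xr|] := ltgtP r x.
  - rewrite (@le_trans _ _ (`|l| + 1))//; last by rewrite lerD2r lerDr.
    move: rx ar; near: r; exact: left_bound.
  - rewrite (@le_trans _ _ (`|g x| + 1))//; last by rewrite lerD2r lerDl.
    move: xr; near: r; exact: right_bound.
  - by move=> ->; have := normr_ge0 l; lra.
have [M bounded] : exists M, forall r, r \in `[a, b] -> `|g r| <= M.
  have := @segment_compact R a b.
  rewrite compact_near_coveringP -near_covering_withinP => cover.
  have : \forall M \near +oo, `[a, b]%classic `<=` (fun r => `|g r| <= M).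
    apply: cover => x /= /locally_bounded[C near_C].
    exists ([set r | a <= r -> `|g r| <= C], [set M | C <= M]) => /=.
      split; first exact: near_C. by apply: nbhs_pinfty_ge; exact: num_real.
    move=> [r M] /= [gC CM]; rewrite in_itv/= => /andP[ar _].
    exact: le_trans (gC ar) CM.
  by move=> /filter_ex[M bM]; exists M.
exists M; split; first exact: num_real.
by move=> N MN r /= /bounded/le_trans; apply; exact: ltW.
Unshelve. all: by end_near. Qed.

Lemma cadlag_integrable {R : realType} (g : R -> R) (a b : R) (T : \bar R) :
  cadlag a T g -> (b%:E < T)%E ->
  lebesgue_measure.-integrable `[a, b] (EFin \o g).
Proof.
move=> g_cadlag bT; have [g_right _] := g_cadlag.
apply: measurable_bounded_integrable => //.
- by rewrite /= lebesgue_measure_itv/=; case: ifP => // _; rewrite -EFinB ltry.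
- apply: measurable_right_continuous => // x; rewrite /= in_itv/= => /andP[ax xb].
  by apply: g_right; split; rewrite // (le_lt_trans _ bT)// lee_fin.
- exact: cadlag_bounded g_cadlag bT.
Qed.

(** The half of the fundamental theorem of calculus that right-continuity of the
    integrand gives: the lower right derivative of the integral is at least the
    integrand. *)
Lemma right_growth_integral {R : realType} (g : R -> R) (a b : R) (T : \bar R) :
  cadlag a T g -> (b%:E < T)%E -> forall t, a <= t -> t < b ->
  forall eps, 0 < eps -> \forall r \near t^'+,
    (g t - eps) * (r - t) <=
    \int[lebesgue_measure]_(s in `[a, r]) g s -
    \int[lebesgue_measure]_(s in `[a, t]) g s.
Proof.
move=> g_cadlag bT t at_ tb eps eps_gt0; have [g_right _] := g_cadlag.
have tT : time_span a T t by split; rewrite // (lt_trans _ bT)// lte_fin.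
have : \forall r \near t^'+, g t - eps <= g r.
  by apply: (cvgr_ge _ (g_right t tT)); lra.
rewrite near_withinE => -[/= d d_gt0 g_ge].
near=> r.
have tr : t < r by near: r; exact: nbhs_right_gt.
have rb : r <= b by near: r; exact: nbhs_right_le.
have rd : r - t < d by near: r; exact: nbhs_right_ltDr.
have int_ar : lebesgue_measure.-integrable `[a, r] (EFin \o g).
  by apply: cadlag_integrable g_cadlag _; rewrite (le_lt_trans _ bT)// lee_fin.
rewrite (Rintegral_itvB int_ar) ?bnd_simp//.
have int_tr : lebesgue_measure.-integrable `]t, r] (EFin \o g).
  by apply: integrableS int_ar => //; apply: subset_itvr; rewrite bnd_simp.
have -> : (g t - eps) * (r - t) = \int[lebesgue_measure]_(s in `]t, r]) (g t - eps).
  by rewrite Rintegral_cst//= lebesgue_measure_itv/= lte_fin tr -EFinB.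
apply: le_Rintegral => //.
  apply: (@measurable_bounded_integrable _ _ _ _ (cst _)) => //.
    by rewrite /= lebesgue_measure_itv/=; case: ifP => // _; rewrite -EFinB ltry.
  exact: bounded_cst.
move=> s /=; rewrite in_itv/= => /andP[ts sr].
apply: g_ge => //=; rewrite distrC gtr0_norm ?subr_gt0//; lra.
Unshelve. all: by end_near. Qed.

(** Integration of a pointwise differential inequality that is only known for the
    right derivative.  [F] minus the integral of [g] is continuous and its upper right
    derivative is at most zero. *)
Lemma increment_le_integral {R : realType} (F g : R -> R) (a b : R) (T : \bar R) :
  a <= b -> (b%:E < T)%E -> cadlag a T g ->
  {within `[a, b], continuous F} ->
  (forall t, a <= t -> t < b -> exists2 d, is_rderive F t d & d <= g t) ->
  F b - F a <= \int[lebesgue_measure]_(t in `[a, b]) g t.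
Proof.
move=> ab bT g_cadlag F_cont F_rderive.
pose G t := \int[lebesgue_measure]_(s in `[a, t]) g s.
have G_cont : {within `[a, b], continuous G}.
  by apply: parameterized_integral_continuous => //; exact: cadlag_integrable bT.
have Ga : G a = 0 by rewrite /G set_itv1 Rintegral_set1.
suff : F b - G b <= F a - G a by rewrite Ga /G; lra.
apply: (@le_of_right_growth _ (fun t => F t - G t)) => //.
  by move=> t; apply: cvgB; [exact: F_cont|exact: G_cont].
move=> t at_ tb eps eps_gt0.
have eps2 : 0 < eps / 2 by rewrite divr_gt0.
have [d F_d dg] := F_rderive t at_ tb.
have : \forall r \near t^'+, (r - t)^-1 *: (F r - F t) <= d + eps / 2.
  have : \forall h \near 0^'+, h^-1 *: (F (t + h) - F t) <= d + eps / 2.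
    by apply: (cvgr_le _ F_d); rewrite ltrDl.
  move=> near_d; apply/nbhs_right0P; apply: filterS near_d => h.
  by rewrite [t + h - t]addrC addKr.
have := right_growth_integral g_cadlag bT at_ tb eps2.
rewrite -/(G t) => near_G near_F.
near=> r.
have tr : 0 < r - t by rewrite subr_gt0; near: r; exact: nbhs_right_gt.
have : (r - t)^-1 *: (F r - F t) <= d + eps / 2 by near: r.
have : (g t - eps / 2) * (r - t) <= G r - G t by near: r.
rewrite /GRing.scale/= => hG; rewrite ler_pdivrMl// => hF.
have : 0 <= (g t - d) * (r - t) by rewrite mulr_ge0 ?subr_ge0// ltW.
lra.
Unshelve. all: by end_near. Qed.

(** * Row blocks of a state vector *)

Section SubmxDifferentiable.
Context {R : realType} {n1 n2 : nat}.
Implicit Types z : 'cV[R]_(n1 + n2).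

Lemma continuous_usubmx :
  continuous (usubmx : 'cV[R]_(n1 + n2) -> 'cV[R]_n1).
Proof.
move=> u A /nbhs_ballP[e /= e0 eA].
apply/nbhs_ballP; exists e => //= v [_ uv]; apply: eA; split => // i j.
by apply: (le_lt_trans _ (uv (lshift n2 i) j)); rewrite !mxE.
Qed.

Lemma continuous_dsubmx :
  continuous (dsubmx : 'cV[R]_(n1 + n2) -> 'cV[R]_n2).
Proof.
move=> u A /nbhs_ballP[e /= e0 eA].
apply/nbhs_ballP; exists e => //= v [_ uv]; apply: eA; split => // i j.
by apply: (le_lt_trans _ (uv (rshift n1 i) j)); rewrite !mxE.
Qed.

Lemma differentiable_usubmx z :
  differentiable (usubmx : 'cV[R]_(n1 + n2) -> 'cV[R]_n1) z.
Proof. exact/linear_differentiable/continuous_usubmx. Qed.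

Lemma differentiable_dsubmx z :
  differentiable (dsubmx : 'cV[R]_(n1 + n2) -> 'cV[R]_n2) z.
Proof. exact/linear_differentiable/continuous_dsubmx. Qed.

End SubmxDifferentiable.

(** * Right-continuous signals with left limits *)

Section Cadlag.
Context {R : realType}.
Implicit Types (s t : R) (T : \bar R).

(** Only the germs of [u] on either side of each time matter. *)
Lemma cadlag_local (W : normedModType R) s T (u : R -> W) :
  (forall t, time_span s T t -> exists v, [/\ cadlag s T v, u t = v t &
     \forall r \near t^'+, u r = v r]) ->
  (forall t, time_span s T t -> s < t -> exists2 v, cadlag s T v &
     \forall r \near t^'-, u r = v r) ->
  cadlag s T u.
Proof.
move=> u_right u_left; split=> t tT.
  have [v [[v_right _] -> uv]] := u_right t tT.
  apply: cvg_trans (v_right t tT); apply: near_eq_cvg.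
  by apply: filterS uv.
move=> st; have [v [_ v_left] uv] := u_left t tT st.
have /cvg_ex[/= l vl] := v_left t tT st.
apply/cvg_ex; exists l; apply: cvg_trans vl; apply: near_eq_cvg.
by apply: filterS uv.
Qed.

Lemma cadlag_cst (W : normedModType R) s T (a : W) : cadlag s T (fun=> a).
Proof. by split=> *; [exact: cvg_cst|exact: is_cvg_cst]. Qed.

Lemma cadlagD (W : normedModType R) s T (u v : R -> W) :
  cadlag s T u -> cadlag s T v -> cadlag s T (fun t => u t + v t).
Proof.
move=> [ur ul] [vr vl]; split=> t tT; first by apply: cvgD; [exact: ur|exact: vr].
by move=> st; apply: is_cvgD; [exact: ul|exact: vl].
Qed.

Lemma cadlagZ (W : normedModType R) s T (k : R) (u : R -> W) :
  cadlag s T u -> cadlag s T (fun t => k *: u t).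
Proof.
move=> [ur ul]; split=> t tT; first by apply: cvgZ; [exact: cvg_cst|exact: ur].
by move=> st; apply: is_cvgZ; [exact: is_cvg_cst|exact: ul].
Qed.

Lemma cvg_dot (m : nat) (F : set_system R) (u v : R -> 'cV[R]_m) (a b : 'cV[R]_m) :
  Filter F -> u r @[r --> F] --> a -> v r @[r --> F] --> b ->
  dot (u r) (v r) @[r --> F] --> dot a b.
Proof.
move=> FF ua vb; rewrite dotE; under eq_cvg do rewrite dotE.
apply: cvg_big => [|i _]; first exact: add_continuous.
apply: cvgM.
  apply: (cvg_comp _ (fun M : 'cV[R]_m => M i 0) ua).
  exact: coord_continuous.
apply: (cvg_comp _ (fun M : 'cV[R]_m => M i 0) vb).
exact: coord_continuous.
Qed.

Lemma cadlag_dot (m : nat) s T (u v : R -> 'cV[R]_m) :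
  cadlag s T u -> cadlag s T v -> cadlag s T (fun t => dot (u t) (v t)).
Proof.
move=> [ur ul] [vr vl]; split=> t tT; first by apply: cvg_dot; [exact: ur|exact: vr].
move=> st; have /cvg_ex[/= a ua] := ul t tT st; have /cvg_ex[/= b vb] := vl t tT st.
by apply/cvg_ex; exists (dot a b); apply: cvg_dot.
Qed.

End Cadlag.

(** * Right derivatives *)

Section RightDerivative.
Context {R : realType} {W : normedModType R}.
Implicit Types (f g : R -> W) (t k : R).

Lemma is_rderiveD f g t l l' : is_rderive f t l -> is_rderive g t l' ->
  is_rderive (fun r => f r + g r) t (l + l').
Proof.
move=> fl gl; apply: cvg_trans (cvgD fl gl); apply: near_eq_cvg.
by apply: nearW => h; rewrite fctE -scalerDr opprD addrACA.
Qed.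

Lemma is_rderiveZ k f t l : is_rderive f t l ->
  is_rderive (fun r => k *: f r) t (k *: l).
Proof.
move=> fl; apply: cvg_trans (cvgZ (cvg_cst k) fl); apply: near_eq_cvg.
by apply: nearW => h /=; rewrite -scalerBr !scalerA mulrC.
Qed.

End RightDerivative.

(** * The event-triggered loop *)

Section Loop.
Context {R : realType} {np nc m : nat}.
Variables (Gp : system R np m) (Gc : system R nc m) (delta : R).

Section Signals.
Variables (T : \bar R) (tk : nat -> \bar R) (w1 w2 : R -> 'cV[R]_m).
Variable r : loop_signals R np nc m.
Hypothesis sol : event_triggered_solution delta Gp Gc T tk w1 w2 r.

Lemma event_fin_num k t : (tk k <= t%:E)%E -> exists2 s, tk k = s%:E & 0 <= s <= t.
Proof.
case: sol => _ [tk0 tk_mono] _ _ tkt.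
have := tk_mono 0%N k (leq0n k); rewrite tk0; move: tkt.
case: (tk k) => [s| |] //; rewrite !lee_fin => st s0.
by exists s; rewrite ?s0.
Qed.

Lemma sampling_interval t : time_span 0 T t ->
  exists k s, [/\ tk k = s%:E, s <= t & (t%:E < tk k.+1)%E].
Proof.
case: sol => _ _ cover _ tT; have [k /andP[kt tk1]] := cover t tT.
by have [s ks /andP[_ st]] := event_fin_num kt; exists k, s.
Qed.

(** The analogue for a left neighbourhood of [t]: when [t] itself is an event
    instant, the relevant sample is the previous one, taken strictly earlier. *)
Lemma sampling_interval_left t : time_span 0 T t -> 0 < t ->
  exists k s, [/\ tk k = s%:E, s < t & (t%:E <= tk k.+1)%E].
Proof.
move=> tT t_gt0; have [k [s [ks st tk1]]] := sampling_interval tT.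
have [lt_st|le_ts] := ltP s t; first by exists k, s; split=> //; exact: ltW.
case: sol => _ [tk0 tk_mono] _ step.
have eq_st : s = t by apply/eqP; rewrite eq_le st.
case: k => [|j] in ks tk1 *.
  by move: ks t_gt0; rewrite tk0 eq_st => -[<-]; rewrite ltxx.
have jt : (tk j <= t%:E)%E by rewrite -eq_st -ks tk_mono.
have [s' js' /andP[_ s't]] := event_fin_num jt.
have s'T : (s'%:E < T)%E by case: tT => _; apply: le_lt_trans; rewrite lee_fin.
have [lt_s' _ _ _] := step j s' js' s'T.
by exists j, s'; rewrite -lte_fin -eq_st -ks.
Qed.

(** The three facts about the interconnection that dissipativity needs; the bound
    on the sampling error is the absence of a triggering time between events. *)
Lemma held_sample k s t : tk k = s%:E -> s <= t -> (t%:E < T)%E ->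
  (t%:E < tk k.+1)%E ->
  [/\ up r t = w1 t - yc r t, uc r t = w2 t + yp r s &
      dot (yp r t - yp r s) (yp r t - yp r s) <= delta * dot (yp r t) (yp r t)].
Proof.
case: sol => _ _ _ step ks st tT tk1.
have sT : (s%:E < T)%E by apply: le_lt_trans tT; rewrite lee_fin.
have [_ held no_trigger _] := step k s ks sT.
have tI : time_span s (mine (tk k.+1) T) t by split; rewrite // lt_min tk1.
have [upE ucE] := held t tI; split=> //.
rewrite leNgt; apply/negP => trigger.
suff : triggering_times delta s (mine (tk k.+1) T) r t by rewrite no_trigger.
by split.
Qed.

(** The external signals inherit their regularity from those of the plant and of
    the controller: [w1 = up + yc], and locally [w2 = uc - yp s] with [s] the last
    sampling instant. *)
Lemma loop_inputs_cadlag : cadlag 0 T w1 /\ cadlag 0 T w2.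
Proof.
have [[[up_c yp_c _ _] [uc_c yc_c _ _]] _ _ _] := sol.
have w1E t : time_span 0 T t -> w1 t = up r t + yc r t.
  move=> tT; have [k [s [ks st tk1]]] := sampling_interval tT.
  by have [-> _ _] := held_sample ks st tT.2 tk1; rewrite subrK.
have near_right t (S : \bar R) : (t%:E < S)%E -> \forall q \near t^'+, (q%:E < S)%E.
  case: S => [S| |]; rewrite ?lte_fin => tS.
  - exact: nbhs_right_lt.
  - by apply: nearW => q; rewrite ltry.
  - by [].
have span_right t : time_span 0 T t -> \forall q \near t^'+, time_span 0 T q.
  move=> [t0 tT]; near=> q; split; last by near: q; exact: near_right.
  by rewrite (le_trans t0)//; near: q; exact: nbhs_right_ge.
have span_left t : time_span 0 T t -> 0 < t -> \forall q \near t^'-, time_span 0 T q.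
  move=> [_ tT] t0; near=> q; split; first by near: q; exact: nbhs_left_ge.
  rewrite (le_lt_trans _ tT)// lee_fin; near: q; exact: nbhs_left_le.
split; apply: cadlag_local => t tT.
- exists (fun q => up r q + yc r q); split; [exact: cadlagD|exact: w1E|].
  by apply: filterS (span_right t tT) => q; exact: w1E.
- move=> t0; exists (fun q => up r q + yc r q); first exact: cadlagD.
  by apply: filterS (span_left t tT t0) => q; exact: w1E.
- have [k [s [ks st tk1]]] := sampling_interval tT.
  have w2E q : s <= q -> (q%:E < T)%E -> (q%:E < tk k.+1)%E ->
      w2 q = uc r q + - yp r s.
    by move=> sq qT qk; have [_ -> _] := held_sample ks sq qT qk; rewrite addrK.
  exists (fun q => uc r q + - yp r s); split.
  + exact: (cadlagD uc_c (cadlag_cst _ _ _)).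
  + exact: w2E tT.2 tk1.
  + near=> q; apply: w2E.
    * by rewrite (le_trans st)//; near: q; exact: nbhs_right_ge.
    * by near: q; exact: near_right tT.2.
    * by near: q; exact: near_right.
- move=> t0; have [k [s [ks st tk1]]] := sampling_interval_left tT t0.
  exists (fun q => uc r q + - yp r s).
    exact: (cadlagD uc_c (cadlag_cst _ _ _)).
  near=> q.
  have qt : (q%:E < t%:E)%E by rewrite lte_fin; near: q; exact: nbhs_left_lt.
  have sq : s <= q by near: q; exact: nbhs_left_ge.
  have [_ -> _] := held_sample ks sq (lt_trans qt tT.2) (lt_le_trans qt tk1).
  by rewrite addrK.
Unshelve. all: by end_near. Qed.

End Signals.

Variables (nup rhop nuc rhoc : R) (Vp : 'cV[R]_np -> R) (Vc : 'cV[R]_nc -> R).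

Definition loop_storage (z : 'cV[R]_(np + nc)) := Vp (usubmx z) + Vc (dsubmx z).

Lemma loop_storage_function :
  storage_function (states Gp) Vp -> storage_function (states Gc) Vc ->
  storage_function (io_states (event_triggered_loop delta Gp Gc)) loop_storage.
Proof.
move=> [Vp_ge0 Vp_diff] [Vc_ge0 Vc_diff]; split=> z [zp zc].
  by rewrite addr_ge0 ?Vp_ge0 ?Vc_ge0.
apply: differentiableD.
  exact: (differentiable_comp (differentiable_usubmx z) (Vp_diff _ zp)).
exact: (differentiable_comp (differentiable_dsubmx z) (Vc_diff _ zc)).
Qed.

Lemma loop_dissipation_inequality :
  dissipation_inequality (io_of_system Gp) Vp
    (fun u y => dot u y - rhop * dot y y - nup * dot u u) ->
  dissipation_inequality (io_of_system Gc) Vc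
    (fun u y => dot u y - rhoc * dot y y - nuc * dot u u) ->
  dissipation_inequality (event_triggered_loop delta Gp Gc) loop_storage
    (fun w y => dot w (Rmx m nup nuc *m w) + 2 * dot w (Smx m nup nuc *m y) +
                dot y (Qmx m nup rhop nuc rhoc delta *m y)).
Proof.
move=> Vp_diss Vc_diss T x w y [tk [w1 [w2 [r [sol -> -> ->]]]]] t tT.
have [[solp solc] _ _ _] := sol.
have [dp Vp_d dp_le] := Vp_diss _ _ _ _ solp t tT.
have [dc Vc_d dc_le] := Vc_diss _ _ _ _ solc t tT.
exists (dp + dc).
  rewrite /loop_storage; under eq_fun do rewrite col_mxKu col_mxKd.
  exact: (is_rderiveD Vp_d Vc_d).
have [k [s [ks st tk1]]] := sampling_interval sol tT.
have [upE ucE e_le] := held_sample sol ks st tT.2 tk1.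
rewrite supply_col_mxE (le_trans (lerD dp_le dc_le))//.
rewrite upE ucE; have -> : w2 t + yp r s = w2 t + yp r t - (yp r t - yp r s).
  by rewrite opprB [yp r s - _]addrC addrA addrK.
exact: loop_supply_le.
Qed.

(** A right derivative does not see a jump from the left limit to the value, so
    integrating the dissipation inequality also needs this. *)
Lemma loop_storage_continuous T tk w1 w2 r t1 :
  storage_function (states Gp) Vp -> storage_function (states Gc) Vc ->
  event_triggered_solution delta Gp Gc T tk w1 w2 r -> (t1%:E < T)%E ->
  {within `[0, t1], continuous
     (fun t => loop_storage (col_mx (xp r t) (xc r t)))}.
Proof.
move=> [_ Vp_diff] [_ Vc_diff] [[[_ _ xp_c xp_s] [_ _ xc_c xc_s]] _ _ _] t1T.
have span : `[0, t1]%classic `<=` time_span 0 T.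
  move=> t /=; rewrite in_itv/= => /andP[t0 tt1]; split=> //.
  by apply: le_lt_trans t1T; rewrite lee_fin.
have -> : (fun t => loop_storage (col_mx (xp r t) (xc r t))) =
    (fun t => Vp (xp r t) + Vc (xc r t)).
  by apply/funext => t; rewrite /loop_storage col_mxKu col_mxKd.
have /subspace_continuousP xpc := continuous_subspaceW span xp_c.
have /subspace_continuousP xcc := continuous_subspaceW span xc_c.
apply/subspace_continuousP => t t_in; have tT := span t t_in.
have [xps _ _] := xp_s t tT; have [xcs _ _] := xc_s t tT.
apply: cvgD.
  apply: (cvg_comp _ Vp (xpc t t_in)).
  exact: differentiable_continuous (Vp_diff _ xps).
apply: (cvg_comp _ Vc (xcc t t_in)).
exact: differentiable_continuous (Vc_diff _ xcs).
Qed.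

(** The storage function is rescaled so that the coefficient of [|y|^2] becomes
    [-1], and the dissipation inequality is then integrated. *)
Lemma loop_L2_stable :
  storage_function (states Gp) Vp -> storage_function (states Gc) Vc ->
  dissipation_inequality (event_triggered_loop delta Gp Gc) loop_storage
    (fun w y => dot w (Rmx m nup nuc *m w) + 2 * dot w (Smx m nup nuc *m y) +
                dot y (Qmx m nup rhop nuc rhoc delta *m y)) ->
  0 < beta rhop delta nuc -> 0 < rhoc + nup - 1 / 4 ->
  L2_stable (event_triggered_loop delta Gp Gc).
Proof.
move=> Vp_st Vc_st diss beta_gt0 c_gt0'.
have [c [K [c_gt0 K_gt0 gain]]] := @supply_le_gain R m _ _ _ _ _ beta_gt0 c_gt0'.
have [V_ge0 _] := loop_storage_function Vp_st Vc_st.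
exists (fun z => c^-1 * loop_storage z), (Num.sqrt K); split.
- by move=> z /V_ge0 Vz; rewrite mulr_ge0// invr_ge0 ltW.
- by rewrite sqrtr_gt0.
rewrite sqr_sqrtr ?ltW// => T x w y traj t1 t1_gt0 t1T.
have [tk [w1 [w2 [r [sol xE wE yE]]]]] := traj.
have [w1_c w2_c] := loop_inputs_cadlag sol.
have [[[_ yp_c _ _] [_ yc_c _ _]] _ _ _] := sol.
apply: (@increment_le_integral _ (fun t => c^-1 * loop_storage (x t)) _ _ _ T) => //.
- exact: ltW.
- rewrite wE yE; under eq_fun do rewrite !dot_col_mx -mulN1r.
  apply: cadlagD; apply: (@cadlagZ _ R^o); apply: cadlagD; exact: cadlag_dot.
- rewrite xE => t; apply: cvgM; first exact: cvg_cst.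
  exact: (loop_storage_continuous Vp_st Vc_st sol t1T).
- move=> t t0 tt1.
  have tT : time_span 0 T t by split=> //; apply: lt_trans t1T; rewrite lte_fin.
  have [d V_d d_le] := diss T x w y traj t tT.
  exists (c^-1 * d); first exact: (@is_rderiveZ _ R^o).
  rewrite ler_pdivrMl// (le_trans d_le)// wE yE supply_col_mxE !dot_col_mx.
  exact: gain.
Qed.

End Loop.

Theorem theorem2 (R : realType) (np nc m : nat)
    (Gp : system R np m) (Gc : system R nc m)
    (nup rhop nuc rhoc delta : R)
    (m_gt0 : (0 < m)%N)
    (Gp_passive : IF_OFP (io_of_system Gp) nup rhop)
    (Gc_passive : IF_OFP (io_of_system Gc) nuc rhoc)
    (delta_gt0 : 0 < delta) (delta_le1 : delta <= 1) :
  let G := event_triggered_loop delta Gp Gc in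
  let S : 'M[R]_(m + m) := Smx m nup nuc in
  let Rm : 'M[R]_(m + m) := Rmx m nup nuc in
  let Q : 'M[R]_(m + m) := Qmx m nup rhop nuc rhoc delta in
  [/\ QSR_dissipative G Q S^T Rm,
      exists2 V, storage_function (io_states G) V &
        dissipation_inequality G V
          (fun w y => dot w (Rm *m w) + 2 * dot w (S *m y) + dot y (Q *m y)),
      negdefmx Q <-> 0 < beta rhop delta nuc /\ 0 < rhoc + nup - 1 / 4 &
      negdefmx Q -> L2_stable G].
Proof.
case: Gp_passive => Vp Vp_storage Vp_diss.
case: Gc_passive => Vc Vc_storage Vc_diss G S Rm Q.
have V_storage : storage_function (io_states G) (loop_storage Vp Vc).
  exact: loop_storage_function.
have V_diss := loop_dissipation_inequality (delta := delta) Vp_diss Vc_diss.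
split.
- split.
  + by rewrite /Q /Qmx tr_block_mx !tr_scalar_mx !trmx0.
  + by rewrite /Rm /Rmx tr_block_mx !tr_scalar_mx !trmx0.
  + exists (loop_storage Vp Vc) => // T x w y traj t tT.
    have [d V_d d_le] := V_diss T x w y traj t tT.
    exists d => //; rewrite dot_mulmx_trmx (le_trans d_le)//.
    by rewrite /= -/Rm -/S -/Q; lra.
- by exists (loop_storage Vp Vc).
- exact: negdef_QmxP.
- move=> /(negdef_QmxP _ _ _ _ _ m_gt0)[beta_gt0 c_gt0].
  exact: loop_L2_stable Vp_storage Vc_storage V_diss beta_gt0 c_gt0.
Qed.
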